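(* For $s\in S$ the following are equivalent: (i) $s$ is an inner point of the moment cone $S$ (i.e. an interior point of $S$ in $\mathbb{R}^m$). (ii) $N_+(s)=\{0\}$. (iii) $W(s)=\mathbb{R}^n$. (iv) $I(s)=\mathbb{R}^n$. (v) $V_+(s)=\mathbb{R}^n$. (vi) $d(s)=0$. (vii) $\Im(s)=\mathbb{R}^m$.
   Context: Let $n\in\mathbb{N}$, $\mathcal X=\mathbb{R}^n$, let $E$ be a finite-dimensional linear subspace of $C^1(\mathbb{R}^n;\mathbb{R})$ and let $F=\{f_1,\dots,f_m\}$ be a fixed vector space basis of $E$. Put $s_F(x)=(f_1(x),\dots,f_m(x))^T\in\mathbb{R}^m$ for $x\in\mathbb{R}^n$, and $f_v(x)=\langle s_F(x),v\rangle$ for $v\in\mathbb{R}^m$ (standard scalar product). Radon measures are nonnegative Borel measures (values in $[0,+\infty]$) that are inner regular with respect to compact sets. For $s=(s_1,\dots,s_m)\in\mathbb{R}^m$ let $L_s$ be the linear functional on $E$ with $L_s(f_j)=s_j$. $s$ is a moment sequence if there is a Radon measure $\mu$ on $\mathbb{R}^n$ such that all $f\in E$ are $\mu$-integrable and $s_j=\int f_j\,d\mu$ for all $j$; such $\mu$ is a representing measure of $s$, and $\mathcal M_s$ is the set of all of them. The moment cone $S\subseteq\mathbb{R}^m$ is the set of all moment sequences. Put $E_+=\{f\in E:f(x)\ge0\ \forall x\in\mathbb{R}^n\}$ and, for $s\in S$, $N_+(s)=\{f\in E_+:L_s(f)=0\}$, $V_+(s)=\{x:f(x)=0\ \forall f\in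 N_+(s)\}$, $W(s)=\{x:\mu(\{x\})>0\text{ for some }\mu\in\mathcal M_s\}$. For $k\in\mathbb{N}$, $C=(c_1,\dots,c_k)\in(0,\infty)^k$ and $X=(x_1,\dots,x_k)\in(\mathbb{R}^n)^k$ (the $x_j$ need not be distinct) let $S_k(C,X)=\sum_{j=1}^k c_j s_F(x_j)$, and let $DS_k(C,X)$ be its total derivative, so that $\operatorname{range}DS_k(C,X)$ is the linear span of the vectors $s_F(x_j)$ and $c_j\,\partial_i s_F(x_j)$, $1\le j\le k$, $1\le i\le n$. Write $(C,X)\in\mathcal M_{k,s}$ if $\sum_{j=1}^k c_j\delta_{x_j}$ is a representing measure of $s$. Define $\Im(s)=\bigcup_{k\in\mathbb{N}}\bigcup_{(C,X)\in\mathcal M_{k,s}}\operatorname{range}DS_k(C,X)$ (a linear subspace of $\mathbb{R}^m$; put $\Im(s)=\{0\}$ if the union is empty), $I(s)=\bigcap_{v\in\Im(s)^\perp}\{x\in\mathbb{R}^n:f_v(x)=0\}$, $d(s)=m-\dim\Im(s)$. *)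

(* Defs.v *)
From mathcomp Require Import all_boot all_order all_algebra.
From mathcomp Require Import all_classical all_reals all_analysis.

Set Implicit Arguments.
Unset Strict Implicit.
Unset Printing Implicit Defensive.

Import Order.TTheory GRing.Theory Num.Theory.
Import numFieldNormedType.Exports.

Local Open Scope classical_set_scope.
Local Open Scope ring_scope.

Definition dotp (R : realType) (m : nat) (u v : 'rV[R]_m) : R :=
  \sum_(j < m) u 0 j * v 0 j.

(* C^1 in the Frechet sense; the derivative is continuous as a map into the
   row vectors, which represent the linear forms on R^n. *)
Definition gradient (R : realType) (n : nat) (f : 'rV[R]_n -> R)
  (x : 'rV[R]_n) : 'rV[R]_n := \row_i 'd f x (delta_mx 0 i).

Definition C1 (R : realType) (n : nat) (f : 'rV[R]_n -> R) : Prop :=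
  (forall x, differentiable f x) /\ continuous (gradient f).

(* The points of R^n with the sigma-algebra generated by the open sets. *)
Definition Borel (R : realType) (n : nat) :=
  g_sigma_algebraType (@open 'rV[R]_n).

(* No local finiteness is required. *)
Definition radon (R : realType) (n : nat)
    (mu : {measure set (Borel R n) -> \bar R}) : Prop :=
  forall A : set (Borel R n), measurable A ->
    mu A = ereal_sup
      [set mu K | K in [set K : set 'rV[R]_n | compact K /\ K `<=` A]].

Section moments.
Context (R : realType) (n m : nat).
Variables (E : set ('rV[R]_n -> R)) (F : 'I_m -> 'rV[R]_n -> R).

Definition s_of (x : 'rV[R]_n) : 'rV[R]_m := \row_j F j x.

Definition f_of (v : 'rV[R]_m) : 'rV[R]_n -> R := fun x => dotp (s_of x) v.

(* f_of v is the linear combination of the F j with coefficients v 0 j. *)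
Definition function_basis : Prop :=
  (forall v, (forall x, f_of v x = 0) -> v = 0) /\ E = range f_of.

(* When F is a basis of E, coords f is the unique coefficient vector of f in E,
   and L_of s is the linear functional on E with value s 0 j at F j. *)
Definition coords (f : 'rV[R]_n -> R) : 'rV[R]_m :=
  xget 0 [set v | f = f_of v].

Definition L_of (s : 'rV[R]_m) (f : 'rV[R]_n -> R) : R := dotp s (coords f).

Definition representing (s : 'rV[R]_m)
    (mu : {measure set (Borel R n) -> \bar R}) : Prop :=
  [/\ radon mu,
      forall f, E f -> mu.-integrable [set: Borel R n] (EFin \o f) &
      forall j, (\int[mu]_x (F j x)%:E = (s 0 j)%:E)%E].

Definition moment_cone : set 'rV[R]_m :=
  [set s | exists mu, representing s mu].

Definition Eplus : set ('rV[R]_n -> R) :=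
  [set f | E f /\ forall x, 0 <= f x].

Definition Nplus (s : 'rV[R]_m) : set ('rV[R]_n -> R) :=
  [set f | Eplus f /\ L_of s f = 0].

Definition Vplus (s : 'rV[R]_m) : set 'rV[R]_n :=
  [set x | forall f, Nplus s f -> f x = 0].

Definition Wset (s : 'rV[R]_m) : set 'rV[R]_n :=
  [set x | exists2 mu : {measure set (Borel R n) -> \bar R},
     representing s mu & (0 < mu [set x])%E].

Definition Smap (k : nat) (CX : 'rV[R]_k * 'M[R]_(k, n)) : 'rV[R]_m :=
  \sum_(j < k) CX.1 0 j *: s_of (row j CX.2).

Definition atomic_representing (s : 'rV[R]_m) (k : nat)
    (CX : 'rV[R]_k * 'M[R]_(k, n)) : Prop :=
  (forall j, 0 < CX.1 0 j) /\
  exists2 mu : {measure set (Borel R n) -> \bar R}, representing s mu &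
    forall A : set (Borel R n), measurable A ->
      (mu A = \sum_(j < k) (CX.1 0 j)%:E * \d_(row j CX.2 : Borel R n) A)%E.

(* Each range contains 0, so adding 0 only matters when the union is empty. *)
Definition Imset (s : 'rV[R]_m) : set 'rV[R]_m :=
  [set 0] `|` [set u | exists k : nat, (0 < k)%N /\
    exists2 CX : 'rV[R]_k * 'M[R]_(k, n),
      atomic_representing s CX & range ('d (@Smap k) CX) u].

Definition Iset (s : 'rV[R]_m) : set 'rV[R]_n :=
  [set x | forall v, (forall u, Imset s u -> dotp u v = 0) -> f_of v x = 0].

End moments.

(* The dimension of a linear subspace given as a set: the largest size of a
   linearly independent family in it. *)
Definition set_dim (R : realType) (m : nat) (A : set 'rV[R]_m) : nat :=
  \max_(k < m.+1 | `[< exists X : k.-tuple 'rV[R]_m,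
                        free X /\ forall u, u \in X -> A u >]) k.

Definition defect (R : realType) (n m : nat) (E : set ('rV[R]_n -> R))
    (F : 'I_m -> 'rV[R]_n -> R) (s : 'rV[R]_m) : nat :=
  (m - set_dim (Imset E F s))%N.

(* Main.v *)
(* Let C be the convex cone generated by the vectors s_F(x), i.e. the set of
   moment sequences of finitely atomic measures. Linear independence of F gives
   finitely many points whose evaluation vectors span R^m; their sum e is an
   interior point of C. If s - r e lies outside C for all r > 0, a nonzero v
   separates s from C: f_v >= 0 on R^n and <s, v> <= 0. As s is a moment
   sequence, <s, v> = L_s(f_v) = 0, so f_v is a nonzero element of N_+(s). Hence
   N_+(s) = {0} forces s = c + r e with c in C and r > 0, where e may be chosen
   to involve any prescribed point x; this representation yields all the other
   conditions.

   Conversely each condition kills every f_v in N_+(s): f_v vanishes at the atoms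
   of representing measures, and v is orthogonal to range DS_k(C,X) whenever
   (C,X) represents s, since <S_k, v> has a local minimum at (C,X). *)

Require Import Defs.
From mathcomp Require Import all_boot all_order all_algebra.
From mathcomp Require Import all_classical all_reals all_analysis.
From mathcomp Require Import measurable_realfun ring lra.

Set Implicit Arguments.
Unset Strict Implicit.
Unset Printing Implicit Defensive.

Import Order.TTheory GRing.Theory Num.Theory.
Import numFieldNormedType.Exports.

Local Open Scope classical_set_scope.
Local Open Scope ring_scope.

(** * Borel measurability and finitely atomic measures *)

Lemma measurable_open_Borel (R : realType) (n : nat) (A : set 'rV[R]_n) :
  open A -> measurable (A : set (Borel R n)).
Proof. by move=> oA; exact: sub_sigma_algebra. Qed.

Lemma measurable_set1_Borel (R : realType) (n : nat) (x : 'rV[R]_n) :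
  measurable ([set x] : set (Borel R n)).
Proof.
rewrite -(setCK [set x]); apply: measurableC.
apply: measurable_open_Borel; apply: closed_openC.
by apply: accessible_closed_set1; apply: hausdorff_accessible; exact: norm_hausdorff.
Qed.

Lemma continuous_measurable_Borel (R : realType) (n : nat) (f : 'rV[R]_n -> R) :
  continuous f -> measurable_fun [set: Borel R n] f.
Proof.
move=> cf; apply: (measurability _ (RGenOInfty.measurableE R)) => //.
move=> _ [_ [a ->] <-]; rewrite setTI.
apply: measurable_open_Borel; apply: open_comp; last exact: interval_open.
by move=> x _; exact: cf.
Qed.

(* The absolute value makes the weights nonnegative without a proof argument. *)
Definition atomic_measure (R : realType) (n k : nat) (c : nat -> R)
    (x : nat -> Borel R n) : {measure set (Borel R n) -> \bar R} :=
  msum (fun j => mscale (NngNum (normr_ge0 (c j))) (dirac (x j))) k.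

Section atomic_measure.
Local Open Scope ereal_scope.
Context (R : realType) (n k : nat) (c : nat -> R) (x : nat -> Borel R n).
Hypothesis c_ge0 : forall j, (0 <= c j)%R.
Local Notation mu := (atomic_measure k c x).

Lemma atomic_measureE (A : set (Borel R n)) :
  mu A = \sum_(j < k) (c j)%:E * \d_(x j) A.
Proof.
apply: eq_bigr => j _; change (`|c j|%R%:E * \d_(x j) A = (c j)%:E * \d_(x j) A).
by rewrite ger0_norm.
Qed.

(** The supremum is attained: intersecting [A] with the finite, hence compact, set of atoms does not
    change the mass. *)
Lemma atomic_measure_radon : radon mu.
Proof.
move=> A mA; apply/eqP; rewrite eq_le; apply/andP; split.
- apply: ereal_sup_ubound.
  exists (A `&` [set` [seq x j | j <- iota 0 k]]).
    split; last by move=> y [].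
    apply: finite_compact; apply: sub_finite_set (finite_seq [seq x j | j <- iota 0 k]).
    by move=> y [].
  rewrite 2!atomic_measureE; apply: eq_bigr => j _; congr (_ * _).
  rewrite /dirac !indicE; congr ((nat_of_bool _)%:R%:E).
  apply/idP/idP; rewrite !inE; first by case.
  move=> Ax; split => //=; apply/mapP; exists (nat_of_ord j) => //.
  by rewrite mem_iota /= add0n.
- apply: ge_ereal_sup => _ [K [_ KA] <-].
  rewrite 2!atomic_measureE; apply: lee_sum => j _.
  rewrite lee_wpmul2l ?lee_fin// /dirac !indicE ler_nat.
  have [xK|] := boolP (x j \in K); last by rewrite leq0n.
  by rewrite (_ : x j \in A)//; rewrite inE in xK; rewrite inE; exact: KA.
Qed.

Lemma ge0_integral_atomic (f : 'rV[R]_n -> \bar R) :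
  measurable_fun [set: Borel R n] f -> (forall y, 0 <= f y) ->
  \int[mu]_y f y = \sum_(j < k) (c j)%:E * f (x j).
Proof.
move=> mf f0; rewrite ge0_integral_measure_sum//; apply: eq_bigr => j _.
by rewrite ge0_integral_mscale//= integral_dirac// diracT mul1e ger0_norm.
Qed.

Lemma integrable_atomic (f : 'rV[R]_n -> R) :
  measurable_fun [set: Borel R n] f -> mu.-integrable [set: Borel R n] (EFin \o f).
Proof.
move=> mf; have mfE : measurable_fun [set: Borel R n] (EFin \o f) by exact/measurable_EFinP.
apply/integrableP; split => //.
rewrite ge0_integral_atomic//; last exact: measurableT_comp.
by apply: lte_sum_pinfty => j _; rewrite /= -EFinM ltry.
Qed.

Lemma integral_atomic (f : 'rV[R]_n -> R) :
  measurable_fun [set: Borel R n] f ->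
  \int[mu]_y (f y)%:E = (\sum_(j < k) (c j * f (x j))%R)%:E.
Proof.
move=> mf; have mfE : measurable_fun [set: Borel R n] (EFin \o f) by exact/measurable_EFinP.
rewrite integralE ge0_integral_atomic//; last exact: measurable_funepos.
rewrite ge0_integral_atomic//; last exact: measurable_funeneg.
under eq_bigr do rewrite funeposE -EFin_max -EFinM.
under [X in _ - X]eq_bigr do rewrite funenegE -EFinN -EFin_max -EFinM.
rewrite !sumEFin -EFinB -sumrB; congr EFin; apply: eq_bigr => j _.
rewrite -mulrBr; congr (_ * _)%R; rewrite /Num.max.
by case: ifPn; case: ifPn; lra.
Qed.

End atomic_measure.

(** * The scalar product on R^m *)

Section dotp.
Context (R : realType) (m : nat).
Implicit Types u v w : 'rV[R]_m.

Lemma dotpDl u v w : dotp (u + v) w = dotp u w + dotp v w.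
Proof. by rewrite /dotp -big_split; apply: eq_bigr => j _; rewrite mxE mulrDl. Qed.

Lemma dotpZl (a : R) u w : dotp (a *: u) w = a * dotp u w.
Proof. by rewrite /dotp mulr_sumr; apply: eq_bigr => j _; rewrite mxE mulrA. Qed.

Lemma dotpNl u w : dotp (- u) w = - dotp u w.
Proof. by rewrite -scaleN1r dotpZl mulN1r. Qed.

Lemma dotp0r u : dotp u 0 = 0.
Proof. by rewrite /dotp big1// => j _; rewrite mxE mulr0. Qed.

Lemma dotp_suml (I : Type) (r : seq I) (P : pred I) (f : I -> 'rV[R]_m) w :
  dotp (\sum_(i <- r | P i) f i) w = \sum_(i <- r | P i) dotp (f i) w.
Proof.
by elim/big_rec2 : _ => [|i x y _ <-]; [rewrite -(scale0r 0) dotpZl mul0r|rewrite dotpDl].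
Qed.

Lemma dotp_ge0 v : 0 <= dotp v v.
Proof. by apply: sumr_ge0 => j _; rewrite -expr2 sqr_ge0. Qed.

Lemma dotp_eq0 v : dotp v v = 0 -> v = 0.
Proof.
move=> /eqP; rewrite psumr_eq0 => [/allP v0|j _]; last by rewrite -expr2 sqr_ge0.
apply/rowP => j; rewrite mxE; apply/eqP; rewrite -sqrf_eq0 expr2.
by apply: (implyP (v0 j _)); rewrite ?mem_index_enum.
Qed.

End dotp.

(** * Separating a point from a convex cone in finite dimension *)

Definition convex_cone (R : realType) (m : nat) (K : set 'rV[R]_m) : Prop :=
  [/\ K 0, forall u v, K u -> K v -> K (u + v) &
      forall a u, 0 < a -> K u -> K (a *: u)].

Section separation.
Context (R : realType) (m : nat).
Implicit Types (K : set 'rV[R]_m) (e b u v s : 'rV[R]_m).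

(* The value of the separating functional at [b] is [a], normalised to be 1 at
   [e]; it is the supremum of the [a] with [b - a *: e] in [K]. *)
Lemma convex_cone_extend K e b : convex_cone K -> ~ K (- e) ->
    (forall u, exists2 r, 0 < r & K (e + r *: u)) ->
  exists a, convex_cone [set u + l *: (b - a *: e) | u in K & l in setT] /\
    ~ [set u + l *: (b - a *: e) | u in K & l in setT] (- e).
Proof.
move=> [K0 KD KZ] Ke core.
have Kneg r : 0 < r -> ~ K (- (r *: e)).
  move=> r0 /(KZ r^-1); rewrite invr_gt0 scalerN scalerA mulVf ?gt_eqF// scale1r.
  by move=> /(_ r0).
pose A := [set a | K (b - a *: e)].
(* Moving from [e] in the direction [b] yields an element of [A]; moving in the direction [- b]
   bounds [A] from above. *)
have A0 : A !=set0.
  have [r r0 /(KZ r^-1)] := core b; rewrite invr_gt0 => /(_ r0) Kr.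
  exists (- r^-1); rewrite /A /= scaleNr opprK.
  by move: Kr; rewrite scalerDr scalerA mulVf ?gt_eqF// scale1r addrC.
have [r r0 /(KZ r^-1)] := core (- b); rewrite invr_gt0 => /(_ r0).
rewrite scalerDr scalerA mulVf ?gt_eqF// scale1r => Kr.
have Aub : ubound A r^-1.
  move=> a Aa; rewrite leNgt; apply/negP => ra.
  apply: (Kneg (a - r^-1)); first by rewrite subr_gt0.
  have := KD _ _ Kr Aa; congr K.
  by rewrite scalerBl opprB -addrA; congr (_ + _); rewrite addrA addNr add0r.
have supA : has_sup A by split => //; exists r^-1.
exists (sup A); split.
  split.
  - by exists 0 => //; exists 0 => //; rewrite scale0r addr0.
  - move=> _ _ [u Ku [l _ <-]] [v Kv [l' _ <-]].
    exists (u + v); first exact: KD.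
    by exists (l + l') => //; rewrite scalerDl addrACA.
  - move=> t _ t0 [u Ku [l _ <-]]; exists (t *: u); first exact: KZ.
    by exists (t * l) => //; rewrite [RHS]scalerDr scalerA.
move=> [u Ku [l _ ule]].
have uE : u = - e - l *: (b - sup A *: e) by rewrite -ule addrK.
(* For [l < 0], rescaling [u] shows that [sup A - l^-1], which exceeds [sup A], lies in [A]. For
   [l > 0], adding [b - a *: e] to [l^-1 *: u], with [a] in [A] above [sup A - l^-1], puts a
   negative multiple of [e] in [K]. *)
have [l0|l0|l0] := ltgtP l 0.
- have l1 : 0 < - l^-1 by rewrite oppr_gt0 invr_lt0.
  have : A (sup A - l^-1).
    have := KZ _ _ l1 Ku; rewrite /A /=; congr K; rewrite uE.
    by apply/rowP => i; rewrite !mxE; field; rewrite lt_eqF.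
  move/(sup_upper_bound supA); lra.
- have l1 : 0 < l^-1 by rewrite invr_gt0.
  have [a Aa sa] := sup_adherent l1 supA.
  apply: (Kneg (a - (sup A - l^-1))); first by rewrite subr_gt0.
  have := KD _ _ (KZ _ _ l1 Ku) Aa; congr K; rewrite uE.
  by apply/rowP => i; rewrite !mxE; field; rewrite gt_eqF.
- by apply: Ke; move: Ku; rewrite uE l0 scale0r subr0.
Qed.

(** Hahn-Banach in finite dimension: [e] is an algebraic interior point, and the cone is enlarged by
    one line per basis vector while [- e] stays outside. The lines finally span the kernel of the
    functional, whose coordinates are the [a j]. *)
Lemma convex_cone_supporting K e : convex_cone K -> ~ K (- e) ->
    (forall u, exists2 r, 0 < r & K (e + r *: u)) ->
  exists2 v, v != 0 & forall u, K u -> 0 <= dotp u v.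
Proof.
move=> cK Ke core.
suff [K' [[K0 KD KZ] K'e KK' [a aP]]] : exists K', [/\ convex_cone K', ~ K' (- e), K `<=` K' &
    exists a : 'I_m -> R, forall j l, K' (l *: (delta_mx 0 j - a j *: e))].
  pose v : 'rV[R]_m := \row_j a j.
  (* Modulo lines contained in [K'], every [u] equals [dotp u v *: e]. *)
  have lin u : K' (u - dotp u v *: e).
    have -> : u - dotp u v *: e =
        \sum_(j < m) u 0 j *: (delta_mx 0 j - a j *: e).
      rewrite [X in X - _](row_sum_delta u) /dotp scaler_suml -sumrB.
      by apply: eq_bigr => j _; rewrite mxE scalerBr scalerA.
    by elim/big_ind : _ => // j _; exact: aP.
  have Kneg r : 0 < r -> ~ K' (- (r *: e)).
    move=> r0 /(KZ r^-1); rewrite invr_gt0 scalerN scalerA mulVf ?gt_eqF// scale1r.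
    by move=> /(_ r0).
  have pos u : K' u -> 0 <= dotp u v.
    move=> Ku; rewrite leNgt; apply/negP => uv0.
    apply: (Kneg (- dotp u v)); first by rewrite oppr_gt0.
    have := KD _ _ Ku (lin (- u)); congr K'.
    by rewrite addrA subrr add0r dotpNl.
  exists v; last by move=> u /KK'; exact: pos.
  (* With [v = 0], [lin] would place [- e] itself in [K']. *)
  apply/eqP => v0; apply: K'e; have := lin (- e).
  by rewrite v0 /dotp big1 ?scale0r ?subr0// => j _; rewrite [X in _ * X]mxE mulr0.
suff H k : (k <= m)%N -> exists K', [/\ convex_cone K', ~ K' (- e), K `<=` K' &
    exists a : 'I_m -> R, forall (j : 'I_m) l, (j < k)%N ->
      K' (l *: (delta_mx 0 j - a j *: e))].
  have [K' [? ? ? [a aP]]] := H m (leqnn m).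
  by exists K'; split => //; exists a => j l; exact: aP.
elim: k => [_|k IH km].
  by exists K; split => //; exists (fun=> 0).
have [K' [cK' K'e KK' [a aP]]] := IH (ltnW km).
have core' u : exists2 r, 0 < r & K' (e + r *: u).
  by have [r r0 ?] := core u; exists r => //; exact: KK'.
pose j0 := Ordinal km.
have [a0 [cK'' K''e]] := convex_cone_extend (delta_mx 0 j0) cK' K'e core'.
exists [set u + l *: (delta_mx 0 j0 - a0 *: e) | u in K' & l in setT]; split => //.
  by move=> u /KK' K'u; exists u => //; exists 0 => //; rewrite scale0r addr0.
exists (fun j : 'I_m => if j == j0 then a0 else a j) => j l jk.
have [->|jj0] := eqVneq j j0.
  by exists 0; [case: cK'|exists l => //; rewrite add0r].
exists (l *: (delta_mx 0 j - a j *: e)); last by exists 0 => //; rewrite scale0r addr0.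
apply: aP; rewrite ltn_neqAle -ltnS jk andbT.
by apply: contra jj0 => /eqP jk'; apply/eqP/val_inj.
Qed.

(* The functional supports the cone generated by [K] and [- s]. *)
Lemma convex_cone_separation K e s : convex_cone K ->
    (forall u, exists2 r, 0 < r & K (e + r *: u)) ->
    (forall r, 0 < r -> ~ K (s - r *: e)) ->
  exists v, [/\ v != 0, forall u, K u -> 0 <= dotp u v & dotp s v <= 0].
Proof.
move=> [K0 KD KZ] core sK.
pose K' := [set u - l *: s | u in K & l in [set l | 0 <= l]].
have KK' : K `<=` K'.
  by move=> u Ku; exists u => //; exists 0 => //=; rewrite scale0r subr0.
have cK' : convex_cone K'.
  split; first exact: KK'.
  - move=> _ _ [u Ku [l l0 <-]] [v Kv [l' l'0 <-]].
    exists (u + v); first exact: KD.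
    by exists (l + l'); [exact: addr_ge0|rewrite scalerDl opprD addrACA].
  - move=> t _ t0 [u Ku [l l0 <-]]; exists (t *: u); first exact: KZ.
    by exists (t * l); [exact: (mulr_ge0 (ltW t0) l0)|rewrite [RHS]scalerBr scalerA].
have K'e : ~ K' (- e).
  move=> [u Ku [l l0 ule]].
  have uE : u = l *: s - e by rewrite -(subrK (l *: s) u) ule addrC.
  move: l0; rewrite /= le_eqVlt => /orP[/eqP l0|l0].
    (* For [l = 0], adding [- e] to a point [e + r *: (s - e)] of [K] leaves a positive multiple of
       [s - e] in [K], against [sK] at 1. *)
    have Ke : K (- e) by rewrite -[- e]add0r -(scale0r s) l0 -uE.
    have [r r0 Kr] := core (s - e).
    apply: (sK 1) => //; rewrite scale1r.
    have r1 : 0 < r^-1 by rewrite invr_gt0.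
    have := KZ _ _ r1 (KD _ _ Kr Ke); congr K.
    by rewrite addrAC subrr add0r scalerA mulVf ?gt_eqF// scale1r.
  have l1 : 0 < l^-1 by rewrite invr_gt0.
  apply: (sK _ l1); have := KZ _ _ l1 Ku; congr K.
  by rewrite uE scalerBr scalerA mulVf ?gt_eqF// scale1r.
have core' u : exists2 r, 0 < r & K' (e + r *: u).
  by have [r r0 ?] := core u; exists r => //; exact: KK'.
have [v v0 vP] := convex_cone_supporting cK' K'e core'.
exists v; split => // [u /KK' /vP//|].
have /vP : K' (- s).
  by exists 0 => //; exists 1 => //=; rewrite scale1r sub0r.
by rewrite dotpNl oppr_ge0.
Qed.

End separation.

(** * The cone of finitely atomic moment sequences *)

Section linear_algebra.
Context (R : realType) (n m : nat) (F : 'I_m -> 'rV[R]_n -> R).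

(** Turns [Smap] into a vector-matrix product, so that spanning by evaluation vectors becomes
    [row_full]. *)
Definition evalmx k (X : 'M[R]_(k, n)) : 'M[R]_(k, m) :=
  \matrix_(i < k) s_of F (row i X).

Definition atomic_cone : set 'rV[R]_m :=
  [set t | exists k (CX : 'rV[R]_k * 'M[R]_(k, n)),
    (forall j, 0 < CX.1 0 j) /\ t = Smap F CX].

Lemma Smap_mulmx k (CX : 'rV[R]_k * 'M[R]_(k, n)) :
  Smap F CX = CX.1 *m evalmx CX.2.
Proof.
by rewrite mulmx_sum_row; apply: eq_bigr => j _; rewrite rowK.
Qed.

Lemma evalmx_col_mx k l (X : 'M[R]_(k, n)) (Y : 'M[R]_(l, n)) :
  evalmx (col_mx X Y) = col_mx (evalmx X) (evalmx Y).
Proof.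
apply/row_matrixP => i; rewrite rowK.
by case: (split_ordP i) => j ->; rewrite ?rowKu ?rowKd rowK.
Qed.

Lemma Smap_row_mx k l (c : 'rV[R]_k) (d : 'rV[R]_l) (X : 'M[R]_(k, n))
    (Y : 'M[R]_(l, n)) :
  Smap F (row_mx c d, col_mx X Y) = Smap F (c, X) + Smap F (d, Y).
Proof. by rewrite !Smap_mulmx /= evalmx_col_mx mul_row_col. Qed.

Lemma row_mx_gt0 k l (c : 'rV[R]_k) (d : 'rV[R]_l) :
  (forall j, 0 < c 0 j) -> (forall j, 0 < d 0 j) -> forall j, 0 < row_mx c d 0 j.
Proof. by move=> c0 d0 j; rewrite mxE; case: fintype.split. Qed.

Lemma convex_cone_atomic : convex_cone atomic_cone.
Proof.
split.
(* The empty family of atoms gives the zero vector. *)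
- exists 0%N, (0, 0); split; first by case=> -[].
  by rewrite /Smap big_ord0.
- move=> _ _ [k [[c X] [/= c0 ->]]] [l [[d Y] [/= d0 ->]]].
  exists (k + l)%N, (row_mx c d, col_mx X Y); split; first exact: row_mx_gt0.
  by rewrite Smap_row_mx.
- move=> a _ a0 [k [[c X] [/= c0 ->]]].
  exists k, (a *: c, X); split; first by move=> j; rewrite mxE mulr_gt0.
  by rewrite !Smap_mulmx scalemxAl.
Qed.

Lemma dotp_mulmx (u v : 'rV[R]_m) : dotp u v = (u *m v^T) 0 0.
Proof. by rewrite !mxE; apply: eq_bigr => j _; rewrite mxE. Qed.

(** While the rank is below [m], some nonzero [v] is orthogonal to all rows; [f_of F v] is nonzero
    at some [x], and the evaluation vector of that [x] lies outside the row span. *)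
Lemma evalmx_full : (forall v, (forall x, f_of F v x = 0) -> v = 0) ->
  exists k (X : 'M[R]_(k, n)), row_full (evalmx X).
Proof.
move=> Ffree.
suff H r : (r <= m)%N -> exists k (X : 'M[R]_(k, n)), (r <= \rank (evalmx X))%N.
  have [k [X rX]] := H m (leqnn m).
  by exists k, X; rewrite /row_full eqn_leq rank_leq_col.
elim: r => [_|r IH rm]; first by exists 0%N, 0.
have [k [X]] := IH (ltnW rm).
rewrite leq_eqVlt => /orP[/eqP rE|]; last by exists k, X.
have : kermx (evalmx X)^T != 0.
  by rewrite kermx_eq0 /row_free mxrank_tr -rE ltn_eqF.
move=> /rowV0Pn[v /sub_kermxP vX v0].
have [x vx] : exists x, f_of F v x <> 0.
  by apply/existsNP => vx; move/eqP: v0; apply; exact: Ffree.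
exists (k + 1)%N, (col_mx X x); rewrite rE evalmx_col_mx.
apply: rank_ltmx.
rewrite ltmxE col_mx_sub submx_refl -addsmxE addsmxSl /=.
apply/negP => /submxP[D xD]; apply: vx.
have -> : f_of F v x = (evalmx x *m v^T) 0 0.
  rewrite /f_of dotp_mulmx; congr ((_ *m _) _ _).
  by apply/row_matrixP => i; rewrite rowK [i]ord1 !row_id.
by rewrite xD -mulmxA -[evalmx X]trmxK -trmx_mul vX trmx0 mulmx0 mxE.
Qed.

(** The direction [u] is a combination of the rows with coefficients [w], and adding a small enough
    multiple of [w] to unit weights keeps them positive. *)
Lemma atomic_cone_core k (X : 'M[R]_(k, n)) : row_full (evalmx X) ->
  forall u, exists2 r, 0 < r & atomic_cone (Smap F (const_mx 1, X) + r *: u).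
Proof.
move=> fX u; have /submxP[w uE] := submx_full u fX.
(* Strictly above every [|w 0 j|], and positive even for [k = 0]. *)
pose N := 1 + \sum_j `|w 0 j|.
have N0 : 0 < N by rewrite ltr_pwDl// sumr_ge0.
have wN j : `|w 0 j| < N.
  by rewrite /N (bigD1 j)//= addrCA ltrDl ltr_pwDl// sumr_ge0.
exists N^-1; first by rewrite invr_gt0.
exists k, (const_mx 1 + N^-1 *: w, X); split => [j|].
  rewrite !mxE /= -ltrBlDl sub0r.
  have : `|N^-1 * w 0 j| < 1.
    by rewrite normrM gtr0_norm ?invr_gt0// mulrC ltr_pdivrMr// mul1r.
  by rewrite ltr_norml => /andP[].
by rewrite !Smap_mulmx /= mulmxDl -scalemxAl uE.
Qed.

End linear_algebra.

(** * Moment functionals and the condition N_+(s) = {0} *)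

Section moment_functional.
Context (R : realType) (n m : nat) (E : set ('rV[R]_n -> R))
  (F : 'I_m -> 'rV[R]_n -> R).
Hypotheses (EC1 : forall f, E f -> C1 f) (EF : function_basis E F).
Implicit Types (s u v : 'rV[R]_m) (x : 'rV[R]_n).

Lemma mem_f_of v : E (f_of F v).
Proof. by case: EF => _ ->; exists v. Qed.

Lemma mem_basis j : E (F j).
Proof.
suff -> : F j = f_of F (delta_mx 0 j) by exact: mem_f_of.
apply/funext => x; rewrite /f_of /dotp (bigD1 j)//= big1 => [|i ij].
  by rewrite !mxE !eqxx mulr1 addr0.
by rewrite !mxE (negbTE ij) andbF mulr0.
Qed.

Lemma measurable_mem (f : 'rV[R]_n -> R) : E f -> measurable_fun [set: Borel R n] f.
Proof.
move=> Ef; apply: continuous_measurable_Borel => x.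
by apply: differentiable_continuous; have [] := EC1 Ef.
Qed.

(** Linear independence of [F] makes the vector chosen by [coords] equal to [v]; the default of
    [xget] never enters. *)
Lemma L_of_f_of s v : L_of F s (f_of F v) = dotp s v.
Proof.
rewrite /L_of; congr dotp; apply/eqP; rewrite -subr_eq0; apply/eqP.
case: EF => inj _; apply: inj => x.
have : [set w | f_of F v = f_of F w] (coords F (f_of F v)).
  by apply: xgetPex; exists v.
move=> /(congr1 (fun f => f x)) /= vw.
transitivity (f_of F (coords F (f_of F v)) x - f_of F v x); last by rewrite -vw subrr.
by rewrite /f_of /dotp -sumrB; apply: eq_bigr => j _; rewrite !mxE mulrBr.
Qed.

Lemma integral_f_of s (mu : {measure set (Borel R n) -> \bar R}) v :
  representing E F s mu -> (\int[mu]_x (f_of F v x)%:E = (dotp s v)%:E)%E.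
Proof.
move=> [_ intE intF].
have intFj j : mu.-integrable [set: Borel R n] (EFin \o F j).
  by apply: intE; exact: mem_basis.
transitivity (\int[mu]_x (\sum_(j < m) (v 0 j)%:E * (F j x)%:E))%E.
  apply: eq_integral => x _; rewrite /f_of /dotp -sumEFin.
  by apply: eq_bigr => j _; rewrite mxE mulrC EFinM.
rewrite integral_sum//; last first.
  by move=> j; apply: integrableZl => //; exact: intFj.
rewrite /dotp -sumEFin; apply: eq_bigr => j _.
by rewrite integralZl ?intF 1?mulrC ?EFinM//; exact: intFj.
Qed.

Lemma moment_cone_ge0 s v : moment_cone E F s -> (forall x, 0 <= f_of F v x) ->
  0 <= dotp s v.
Proof.
move=> [mu rep] v0; rewrite -lee_fin -(integral_f_of v rep).
by apply: integral_ge0 => x _; rewrite lee_fin.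
Qed.

(** Translates the condition into coefficient vectors, the language of separation and
    orthogonality. *)
Lemma Nplus_eq0P s : Nplus E F s = [set fun=> 0] <->
  forall v, (forall x, 0 <= f_of F v x) -> dotp s v = 0 -> v = 0.
Proof.
case: (EF) => inj EE; split => [N0 v v0 sv0|N0].
  apply: inj => x.
  suff : Nplus E F s (f_of F v) by rewrite N0 => ->.
  by split; [split => //; exact: mem_f_of|rewrite L_of_f_of].
have f0 : f_of F 0 = fun=> 0 by apply/funext => x; rewrite /f_of dotp0r.
apply/seteqP; split => [f [[]]|_ ->].
  rewrite EE => -[v _ <-] v0; rewrite L_of_f_of => sv0.
  by rewrite (N0 v).
rewrite -f0; split; last by rewrite L_of_f_of dotp0r.
by split => [|x]; [exact: mem_f_of|rewrite f0].
Qed.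

Lemma atomic_representing_Smap k (CX : 'rV[R]_k * 'M[R]_(k, n)) :
  (forall j, 0 < CX.1 0 j) -> atomic_representing E F (Smap F CX) CX.
Proof.
move=> c_gt0; split => //.
(* [atomic_measure] takes sequences indexed by [nat]; outside ['I_k] they are padded with 0. *)
pose c j := oapp (fun i : 'I_k => CX.1 0 i) 0 (insub j).
pose x j : Borel R n := oapp (fun i : 'I_k => row i CX.2) 0 (insub j).
have c_ge0 j : 0 <= c j by rewrite /c; case: insub => //= i; exact: ltW.
have cE (i : 'I_k) : c i = CX.1 0 i by rewrite /c valK.
have xE (i : 'I_k) : x i = row i CX.2 by rewrite /x valK.
exists (atomic_measure k c x); last first.
  move=> A mA; rewrite atomic_measureE//; apply: eq_bigr => j _.
  by rewrite cE xE.
split.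
- exact: atomic_measure_radon.
- move=> f Ef; apply: integrable_atomic => //. exact: measurable_mem.
- move=> j; rewrite integral_atomic//; last by apply: measurable_mem; exact: mem_basis.
  by rewrite /Smap summxE; congr EFin; apply: eq_bigr => i _; rewrite !mxE cE xE.
Qed.

Lemma moment_cone_Smap k (CX : 'rV[R]_k * 'M[R]_(k, n)) :
  (forall j, 0 < CX.1 0 j) -> moment_cone E F (Smap F CX).
Proof. by move=> /atomic_representing_Smap[_ [mu]]; exists mu. Qed.

(** Serves three conditions: full rank of the evaluation vectors gives the interior point and Im(s)
    = R^m, the free choice of the atom [x] gives W(s) = R^n. *)
Lemma Nplus0_atomic s x : moment_cone E F s -> Nplus E F s = [set fun=> 0] ->
  exists k (CX : 'rV[R]_k * 'M[R]_(k, n)),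
    [/\ forall j, 0 < CX.1 0 j, s = Smap F CX, row_full (evalmx F CX.2) &
        exists j, row j CX.2 = x].
Proof.
move=> Ss /Nplus_eq0P N0; case: (EF) => inj _.
have [k [X fX]] := evalmx_full inj.
(* Prepending [x] keeps the rank full and makes [x] an atom of [e]. *)
pose Y : 'M[R]_(1 + k, n) := col_mx x X.
have fY : row_full (evalmx F Y).
  rewrite evalmx_col_mx -sub1mx -addsmxE.
  by apply: submx_trans (addsmxSr _ _); rewrite sub1mx.
pose e := Smap F (const_mx 1, Y).
have [[r [r0 [l [[d Z] [/= d0 sE]]]]]|H] :=
    pselect (exists r, 0 < r /\ atomic_cone F (s - r *: e)); last first.
  exfalso; have sK r : 0 < r -> ~ atomic_cone F (s - r *: e).
    by move=> r0 Kr; apply: H; exists r.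
  (* f_v is nonnegative since each s_F(y) lies in the cone; [s] being a moment sequence turns <s, v>
     <= 0 into an equality, against [N0]. *)
  have [v [/eqP v0 vP sv]] :=
    convex_cone_separation (convex_cone_atomic F) (atomic_cone_core fY) sK.
  have vpos y : 0 <= f_of F v y.
    apply: vP; exists 1%N, (const_mx 1, y); split => [j|].
      by rewrite mxE.
    by rewrite /Smap big_ord1 mxE scale1r row_id.
  apply/v0/N0 => //; apply/eqP; rewrite eq_le sv /=; exact: moment_cone_ge0.
(* [s] is [r *: e] plus an element of the cone: weight [r] on the rows of [Y], weights [d] on those
   of [Z]. *)
exists (1 + k + l)%N, (row_mx (const_mx r) d, col_mx Y Z); split => /=.
- by apply: row_mx_gt0 => // j; rewrite mxE.
- have rE : const_mx r = r *: const_mx 1 :> 'rV[R]_(1 + k).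
    by apply/rowP => j; rewrite !mxE mulr1.
  have eE : Smap F (const_mx r, Y) = r *: e.
    by rewrite /e !Smap_mulmx /= rE scalemxAl.
  by rewrite Smap_row_mx -sE eE addrCA subrr addr0.
- rewrite evalmx_col_mx -sub1mx -addsmxE.
  by apply: submx_trans (addsmxSl _ _); rewrite sub1mx.
- by exists (lshift l (lshift k 0)); rewrite !rowKu row_id.
Qed.

End moment_functional.

(** * The derivative of S_k *)

Section differentiability.
Context (R : realType).

Lemma differentiable_sum_fun (V W : normedModType R) k (f : 'I_k -> V -> W) x :
  (forall i, differentiable (f i) x) ->
  differentiable (fun y => \sum_(i < k) f i y) x.
Proof.
move=> df; rewrite (_ : (fun _ => _) = \sum_(i < k) f i).
  exact: differentiable_sum.
by apply/funext => y; rewrite fct_sumE.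
Qed.

Lemma differentiable_row (V : normedModType R) m (f : V -> 'rV[R]_m) x :
  (forall j, differentiable (fun y => f y 0 j) x) -> differentiable f x.
Proof.
move=> df.
rewrite (_ : f = fun y => \sum_(j < m) f y 0 j *: (delta_mx 0 j : 'rV[R]_m)).
  by apply: differentiable_sum_fun => j; exact: differentiableZl.
by apply/funext => y; rewrite -row_sum_delta.
Qed.

Lemma differentiable_dotp m (v u : 'rV[R]_m) :
  differentiable (fun u : 'rV[R]_m => dotp u v) u.
Proof.
apply: differentiable_sum_fun => j.
by apply: differentiableM => //; exact: differentiable_coord.
Qed.

Lemma continuous_dotp m (v : 'rV[R]_m) : continuous (fun u : 'rV[R]_m => dotp u v).
Proof. by move=> u; apply: differentiable_continuous; exact: differentiable_dotp. Qed.

Lemma differentiable_fst (V W : normedModType R) (x : V * W) :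
  differentiable (fst : V * W -> V) x.
Proof. by apply: linear_differentiable => y; exact: cvg_fst. Qed.

Lemma differentiable_snd (V W : normedModType R) (x : V * W) :
  differentiable (snd : V * W -> W) x.
Proof. by apply: linear_differentiable => y; exact: cvg_snd. Qed.

Context (n m : nat) (F : 'I_m -> 'rV[R]_n -> R).
Hypothesis dF : forall j x, differentiable (F j) x.

Lemma differentiable_Smap k (y : 'rV[R]_k * 'M[R]_(k, n)) :
  differentiable (@Smap R n m F k) y.
Proof.
apply: differentiable_row => l.
rewrite (_ : (fun _ => _) = fun CX : 'rV[R]_k * 'M[R]_(k, n) =>
    \sum_(j < k) CX.1 0 j * F l (row j CX.2)); last first.
  by apply/funext => CX; rewrite summxE; apply: eq_bigr => j _; rewrite !mxE.
apply: differentiable_sum_fun => j; apply: differentiableM.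
  exact: (differentiable_comp (differentiable_fst y) (differentiable_coord _ 0 j)).
have drow : differentiable (fun X : 'M[R]_(k, n) => row j X) y.2.
  apply: differentiable_row => i.
  rewrite (_ : (fun _ => _) = fun X : 'M[R]_(k, n) => X j i).
    exact: differentiable_coord.
  by apply/funext => X; rewrite mxE.
have drow2 := differentiable_comp (differentiable_snd y) drow.
exact: (differentiable_comp drow2 (dF l _)).
Qed.

(** [Smap] is linear in the weights, so the difference quotient is constant for nonzero [h]. Weight
    directions alone thus put the row space of [evalmx F X] in the range of the derivative. *)
Lemma diff_Smap_weights k (c w : 'rV[R]_k) (X : 'M[R]_(k, n)) :
  'd (@Smap R n m F k) (c, X) (w, 0) = w *m evalmx F X.
Proof.
rewrite -deriveE; last exact: differentiable_Smap.
apply/cvg_lim => //; apply: cvg_near_cst.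
near=> h.
have hE : h *: (w, 0 : 'M[R]_(k, n)) + (c, X) = (h *: w + c, X).
  by congr pair; rewrite /= scaler0 add0r.
rewrite /= hE !Smap_mulmx /= mulmxDl addrK -scalemxAl scalerA.
by rewrite mulVf ?scale1r//; near: h; exact: nbhs_dnbhs_neq.
Unshelve. all: by end_near. Qed.

(* [dotp (Smap F _) v] is a nonnegative function on positive weights that
   vanishes at [CX], where it therefore has a local minimum. *)
Lemma diff_Smap_orthogonal k (CX : 'rV[R]_k * 'M[R]_(k, n)) v H :
  (forall j, 0 < CX.1 0 j) -> (forall x, 0 <= f_of F v x) ->
  dotp (Smap F CX) v = 0 -> dotp ('d (@Smap R n m F k) CX H) v = 0.
Proof.
move=> c0 v0 sv0.
(* The inequality for [H] and for [- H] gives equality. *)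
suff ge0 K : 0 <= dotp ('d (@Smap R n m F k) CX K) v.
  apply/eqP; rewrite eq_le ge0 andbT -oppr_ge0 -dotpNl.
  by rewrite -linearN ge0.
have dS := differentiable_Smap CX.
rewrite -deriveE//.
have := diff_derivable (v := K) dS; rewrite /derivable => /cvg_dnbhs_at_right.
rewrite -/(derive _ _ _) => cvgdv.
have {}cvgdv : dotp (h^-1 *: (Smap F (h *: K + CX) - Smap F CX)) v @[h --> 0^'+]
    --> dotp ('D_K (@Smap R n m F k) CX) v.
  exact: (continuous_cvg _ (@continuous_dotp _ v _) cvgdv).
(* For small [h > 0] the shifted weights are still positive, so the right-hand difference quotients
   are nonnegative; the points may move freely because f_v >= 0 everywhere. *)
rewrite -(cvg_lim _ cvgdv)//; have Kpos j : \forall h \near 0^'+, 0 < (h *: K + CX).1 0 j.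
  have : (h * K.1 0 j + CX.1 0 j) @[h --> (0 : R)^'+] --> CX.1 0 j.
    have Kh : (h * K.1 0 j) @[h --> (0 : R)] --> 0 * K.1 0 j.
      by apply: cvgMr_tmp; exact: cvg_id.
    have := cvgD Kh (cvg_cst (CX.1 0 j)); rewrite mul0r add0r => cK.
    by apply: cvg_at_right_filter; exact: cK.
  move=> /cvgr_gt/(_ _ (c0 j)); apply: filterS => h.
  by rewrite !mxE.
apply: limr_ge.
  by apply/cvg_ex; eexists; exact: cvgdv.
near=> h.
have h0 : 0 < h by near: h; exact: nbhs_right_gt.
rewrite dotpZl dotpDl dotpNl sv0 subr0.
apply: mulr_ge0; first by rewrite invr_ge0 ltW.
rewrite dotp_suml. apply: sumr_ge0 => j _; rewrite dotpZl mulr_ge0//; last exact: v0.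
by apply/ltW; move: j; near: h; exact: filter_forall.
Unshelve. all: by end_near. Qed.

End differentiability.

(** * Dimension of a subset of R^m *)

Section set_dim.
Context (R : realType) (m : nat).
Implicit Types (A : set 'rV[R]_m).

Lemma dim_rV : \dim {:'rV[R]_m} = m.
Proof. by rewrite dimvf dim_matrix; exact: mul1n. Qed.

Lemma set_dim_setT : set_dim [set: 'rV[R]_m] = m.
Proof.
apply/eqP; rewrite eqn_leq; apply/andP; split.
  by apply/bigmax_leqP => k _; rewrite -ltnS.
apply: (@leq_bigmax_cond _ _ (@nat_of_ord m.+1) ord_max); apply/asboolP => /=.
exists (tcast dim_rV (vbasis {:'rV[R]_m})); split => //.
by rewrite val_tcast (basis_free (vbasisP _)).
Qed.

(** Without a free family of size [m] in [A], every size counted by the maximum is at most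
    [m.-1]. *)
Lemma set_dim_full_free A : (m <= set_dim A)%N ->
  exists X : m.-tuple 'rV[R]_m, free X /\ forall u, u \in X -> A u.
Proof.
move=> mA; apply: contrapT => noX.
(* For [m = 0] the empty family works; there [m.-1] is 0 and the bound below would give no
   contradiction. *)
have m0 : (0 < m)%N.
  rewrite lt0n; apply/eqP => m0; apply: noX.
  exists (tcast (esym m0) [tuple]); split; last by move=> u; rewrite memtE val_tcast.
  by rewrite val_tcast nil_free.
have : (set_dim A <= m.-1)%N.
  apply/bigmax_leqP => k /asboolP[X [fX XA]]; rewrite -ltnS prednK// ltn_neqAle.
  rewrite -ltnS ltn_ord andbT; apply/eqP => km; apply: noX.
  exists (tcast km X); rewrite val_tcast; split => // u.
  by rewrite memtE val_tcast; exact: XA.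
by move=> /(leq_trans mA); rewrite leqNgt prednK ?leqnn.
Qed.

(** The [m] free vectors form a basis, so [v] is orthogonal to itself. *)
Lemma free_full_orthogonal (X : m.-tuple 'rV[R]_m) (v : 'rV[R]_m) :
  free X -> (forall u, u \in X -> dotp u v = 0) -> v = 0.
Proof.
move=> fX Xv; apply: dotp_eq0.
have bX : basis_of {:'rV[R]_m} X.
  by rewrite basisEfree fX subvf size_tuple dim_rV leqnn.
rewrite [X in dotp X _](coord_basis bX (memvf v)) dotp_suml big1// => i _.
by rewrite dotpZl Xv ?mulr0// mem_nth ?size_tuple.
Qed.

End set_dim.

(** * The implications between the seven conditions *)

Section main.
Context (R : realType) (n m : nat) (E : set ('rV[R]_n -> R))
  (F : 'I_m -> 'rV[R]_n -> R).
Hypotheses (EC1 : forall f, E f -> C1 f) (EF : function_basis E F).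
Implicit Types (s u v : 'rV[R]_m) (x : 'rV[R]_n).

Lemma differentiable_basis j x : differentiable (F j) x.
Proof. by have [] := EC1 (mem_basis EF j). Qed.

(** The measure in the hypothesis agrees on measurable sets with the one from
    [atomic_representing_Smap], so both have the same moments. *)
Lemma atomic_representing_eq s k (CX : 'rV[R]_k * 'M[R]_(k, n)) :
  atomic_representing E F s CX -> s = Smap F CX.
Proof.
move=> [c0 [mu [_ _ mus] muE]].
apply/rowP => j; apply: EFin_inj; rewrite -mus.
have [_ [nu [_ _ nus] nuE]] := atomic_representing_Smap EC1 EF c0.
rewrite -nus; by apply: eq_measure_integral => A mA _; rewrite muE// nuE.
Qed.

(** Carries the conditions on I(s), d(s) and Im(s) back to N_+(s). *)
Lemma Imset_orthogonal s u v : (forall x, 0 <= f_of F v x) -> dotp s v = 0 ->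
  Imset E F s u -> dotp u v = 0.
Proof.
move=> v0 sv0 [->|[k [_ [CX rep [H _ <-]]]]].
  by rewrite -(scale0r (0 : 'rV[R]_m)) dotpZl mul0r.
have c0 : forall j, 0 < CX.1 0 j by case: rep.
apply: diff_Smap_orthogonal => //; first exact: differentiable_basis.
by rewrite -(atomic_representing_eq rep).
Qed.

(** For small [t > 0] the point [s - t *: v] is still a moment sequence, and pairing it with [v]
    gives [t * dotp v v <= 0]. *)
Lemma interior_Nplus s : interior (moment_cone E F) s ->
  Nplus E F s = [set fun=> 0].
Proof.
move=> sint; apply/(Nplus_eq0P EF) => v v0 sv0.
have cvgs : s - t *: v @[t --> (0 : R)] --> s.
  rewrite -[X in _ --> X]subr0 -(scale0r v).
  by apply: cvgB; [exact: cvg_cst|apply: cvgZr_tmp; exact: cvg_id].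
have /nbhs_ballP[r /= r0 rS] := cvgs _ sint.
(* [r] is a radius in the parameter [t]; half of it lies strictly inside the ball. *)
have : moment_cone E F (s - (r / 2) *: v).
  apply: rS; rewrite /ball /= sub0r normrN gtr0_norm ?divr_gt0//.
  by rewrite ltr_pdivrMr// mulr_natr mulr2n ltrDl.
move=> /(moment_cone_ge0 EF) /(_ v0).
rewrite dotpDl dotpNl dotpZl sv0 sub0r oppr_ge0 pmulr_rle0 ?divr_gt0// => vv.
by apply: dotp_eq0; apply/eqP; rewrite eq_le vv dotp_ge0.
Qed.

(** The pseudo-inverse of the evaluation matrix yields weights for every [u] on the same atoms; they
    depend affinely on [u] and equal [c] at [s], so they stay positive nearby. *)
Lemma Nplus_interior s : moment_cone E F s -> Nplus E F s = [set fun=> 0] ->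
  interior (moment_cone E F) s.
Proof.
move=> Ss /(Nplus0_atomic EF 0 Ss)[k [[c X] [/= c0 -> fX _]]].
set s0 := Smap F (c, X).
pose P := pinvmx (evalmx F X).
have near_pos j : \forall u \near s0, 0 < (c + (u - s0) *m P) 0 j.
  have cE u : (c + (u - s0) *m P) 0 j =
      dotp u (col j P)^T + (c 0 j - dotp s0 (col j P)^T).
    rewrite addrCA -dotpNl -dotpDl !mxE; congr (_ + _).
    by apply: eq_bigr => i _; rewrite !mxE.
  have : dotp u (col j P)^T + (c 0 j - dotp s0 (col j P)^T) @[u --> s0] --> c 0 j.
    have := cvgD (@continuous_dotp _ _ (col j P)^T s0)
      (cvg_cst (c 0 j - dotp s0 (col j P)^T)).
    by rewrite (addrC (dotp s0 _)) subrK => cD; exact: cD.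
  move=> /cvgr_gt/(_ _ (c0 j)); apply: filterS => u.
  by rewrite -cE.
have : \forall u \near s0, forall j, 0 < (c + (u - s0) *m P) 0 j.
  exact: (@filter_forall _ _ (fun j u => 0 < (c + (u - s0) *m P) 0 j) (nbhs s0)).
apply: filterS => u uc.
have -> : u = Smap F (c + (u - s0) *m P, X).
  rewrite Smap_mulmx /= mulmxDl mulmxKpV ?submx_full//.
  by rewrite /s0 Smap_mulmx /= addrC subrK.
exact: moment_cone_Smap.
Qed.

Lemma Nplus_Wset s : moment_cone E F s -> Nplus E F s = [set fun=> 0] ->
  Wset E F s = setT.
Proof.
move=> Ss N0; apply/seteqP; split => // x _.
have [k [CX [c0 -> _ [j jx]]]] := Nplus0_atomic EF x Ss N0.
have [_ [mu rep muE]] := atomic_representing_Smap EC1 EF c0.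
exists mu => //; rewrite muE; last exact: measurable_set1_Borel.
rewrite (bigD1 j)//=; apply: lt_le_trans (leeDl _ _); last first.
  by apply: sume_ge0 => i _; rewrite mule_ge0// lee_fin ltW.
by rewrite jx /dirac indicE mem_set// mule1 lte_fin.
Qed.

Lemma Nplus_Imset s : moment_cone E F s -> Nplus E F s = [set fun=> 0] ->
  Imset E F s = setT.
Proof.
move=> Ss N0; apply/seteqP; split => // u _; right.
(* The atom at 0 is an arbitrary choice; its index [j] witnesses [k > 0]. *)
have [k [[c X] [c0 sE fX [j _]]]] := Nplus0_atomic EF 0 Ss N0.
exists k; split; first by case: k c X c0 sE fX j => // ? ? ? ? ? [].
exists (c, X); first by rewrite sE; exact: atomic_representing_Smap.
have /submxP[w ->] := submx_full u fX.
exists (w, 0) => //; apply: diff_Smap_weights.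
exact: differentiable_basis.
Qed.

(** The mass at [x] bounds the integral from below: 0 <= f_v(x) mu({x}) <= <s, v> = 0, and mu({x}) >
    0 forces f_v(x) = 0. *)
Lemma Wset_Nplus s : Wset E F s = setT -> Nplus E F s = [set fun=> 0].
Proof.
move=> WT; apply/(Nplus_eq0P EF) => v v0 sv0; case: (EF) => inj _; apply: inj => x.
have [mu rep mux] : Wset E F s x by rewrite WT.
have mx := measurable_set1_Borel x.
have mf : measurable_fun [set: Borel R n] (EFin \o f_of F v).
  by apply/measurable_EFinP; apply: (measurable_mem EC1); exact: mem_f_of.
have int0 : (\int[mu]_(y in [set x]) (f_of F v y)%:E)%E = 0%E.
  apply/eqP; rewrite eq_le; apply/andP; split; last first.
    by apply: integral_ge0 => y _; rewrite lee_fin.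
  rewrite -[leRHS]/((0 : R)%:E) -sv0 -(integral_f_of EF v rep).
  by apply: ge0_subset_integral => // y _; rewrite lee_fin.
have : (\int[mu]_(y in [set x]) (f_of F v x)%:E)%E = 0%E.
  by rewrite -[RHS]int0; apply: eq_integral => y; rewrite inE => ->.
rewrite integral_cst// => /eqP; rewrite mule_eq0 (gt_eqF mux) orbF => /eqP.
by case.
Qed.

End main.

Theorem theorem40 (R : realType) (n m : nat) (E : set ('rV[R]_n -> R))
    (F : 'I_m -> 'rV[R]_n -> R)
    (EC1 : forall f, E f -> C1 f) (EF : function_basis E F)
    (s : 'rV[R]_m) (Ss : moment_cone E F s) :
  [<-> interior (moment_cone E F) s;
       Nplus E F s = [set fun=> 0];
       Wset E F s = [set: 'rV[R]_n];
       Iset E F s = [set: 'rV[R]_n];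
       Vplus E F s = [set: 'rV[R]_n];
       defect E F s = 0%N;
       Imset E F s = [set: 'rV[R]_m]].
Proof.
have inj := EF.1.
(* The cycle follows the listed order; from the third implication on, each one first recovers N_+(s)
   = {0}. *)
tfae.
- exact: interior_Nplus.
- exact: Nplus_Wset.
- move=> /(Wset_Nplus EC1 EF)/(Nplus_Imset EC1 EF Ss) IT.
  apply/seteqP; split => // x _ v Iv; rewrite (_ : v = 0) /f_of ?dotp0r//.
  by apply: dotp_eq0; apply: Iv; rewrite IT.
- move=> IT; have N0 : Nplus E F s = [set fun=> 0].
    apply/(Nplus_eq0P EF) => v v0 sv0; apply: inj => x.
    have : Iset E F s x by rewrite IT.
    by apply => u; exact: Imset_orthogonal.
  by apply/seteqP; split => // x _ f; rewrite N0 => ->.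
- move=> VT; rewrite /defect (Nplus_Imset EC1 EF Ss) ?set_dim_setT ?subnn//.
  apply/(Nplus_eq0P EF) => v v0 sv0; apply: inj => x.
  have : Vplus E F s x by rewrite VT.
  apply; split; last by rewrite (L_of_f_of EF).
  by split => //; exact: mem_f_of.
(* With truncated subtraction, a zero defect says that [m] is at most the dimension, which already
   provides [m] free vectors in Im(s). *)
- move=> /eqP; rewrite subn_eq0 => /set_dim_full_free[X [fX XI]].
  apply: (Nplus_Imset EC1 EF Ss); apply/(Nplus_eq0P EF) => v v0 sv0.
  by apply: free_full_orthogonal fX _ => u /XI; exact: Imset_orthogonal.
- move=> IT; apply: Nplus_interior => //; apply/(Nplus_eq0P EF) => v v0 sv0.
  by apply: dotp_eq0; apply: (Imset_orthogonal EC1 EF v0 sv0); rewrite IT.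
Qed.
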